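(* Let $s\ge 1$ and $t\ge 1$ be integers. Then $\chi_p(P_{3t}\Diamond_3 C_{4s+3})\le 4$ if $1\le t\le 2$, and $\chi_p(P_{3t}\Diamond_3 C_{4s+3})\le 5$ if $t\ge 3$. Moreover, equality holds for $t\in\{1,2\}$.
   Context: A packing $k$-coloring of a graph $H$ is a map $c:V(H)\to\{1,\ldots,k\}$ such that any two distinct vertices $u,v$ with $c(u)=c(v)=i$ satisfy $d_H(u,v)\ge i+1$. The packing chromatic number $\chi_p(H)$ is the least such $k$. $P_m$ denotes the path $v_1\cdots v_m$ and $C_n$ the cycle on $n$ vertices. Path-aligned product: for positive integers $\ell\mid m$ and a connected vertex-transitive graph $G$ containing $P_\ell$ as a subgraph, $P_m\Diamond_\ell G$ is formed from the path $P_m=v_1\cdots v_m$ and $m/\ell$ pairwise disjoint copies of $G$, where for each $1\le i\le m/\ell$ the consecutive path vertices $v_{(i-1)\ell+1},\ldots,v_{i\ell}$ are identified, in order, with the vertices of a path $P_\ell$ (i.e. $\ell$ consecutive cycle vertices when $G$ is a cycle) in the $i$-th copy of $G$. *)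

(* Defs.v *)
From HB Require Import structures.
From mathcomp Require Import all_boot.

Set Implicit Arguments.
Unset Strict Implicit.
Unset Printing Implicit Defensive.

(* A finite simple graph is a symmetric irreflexive relation e on a finType. *)

Section Packing.
Variables (T : finType) (e : rel T).

Definition walk (n : nat) (x y : T) : bool :=
  [exists p : n.-tuple T, path e x p && (last x p == y)].

Lemma connect_walk (x y : T) : connect e x y -> exists n, walk n x y.
Proof.
case/connectP=> p ep ->; exists (size p).
by apply/existsP; exists (in_tuple p); rewrite ep eqxx.
Qed.

(* None stands for infinite distance (different connected components). *)
Definition dist (x y : T) : option nat :=
  match boolP (connect e x y) with
  | AltTrue cxy => Some (ex_minn (connect_walk cxy))
  | AltFalse _ => None
  end.

Definition dist_ge (x y : T) (d : nat) : bool :=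
  if dist x y is Some d' then d <= d' else true.

(* The colour of v is (c v).+1, so that colours range over {1, ..., k};
   two vertices of colour i = (c u).+1 must be at distance >= i + 1. *)
Definition packing_coloring (k : nat) (c : {ffun T -> 'I_k}) : bool :=
  [forall u, forall v,
     (u != v) && (c u == c v) ==> dist_ge u v ((c u).+1 + 1)].

Definition packing_colorable (k : nat) : bool :=
  [exists c : {ffun T -> 'I_k}, packing_coloring c].

Lemma packing_colorable_card : exists k, packing_colorable k.
Proof.
exists #|T|; apply/existsP; exists [ffun x => enum_rank x].
apply/forallP=> u; apply/forallP=> v; apply/implyP=> /andP[/negP nuv].
by rewrite !ffunE => /eqP/enum_rank_inj uv; case: nuv; apply/eqP.
Qed.

Definition packing_chromatic : nat := ex_minn packing_colorable_card.

End Packing.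

Definition path_graph (m : nat) : rel 'I_m :=
  fun i j => (j == i.+1 :> nat) || (i == j.+1 :> nat).

Definition cycle_graph (n : nat) : rel 'I_n :=
  fun i j => (j == ordS i) || (i == ordS j).

(* p lists, in order, the vertices of a path P_l that is a (not necessarily
   induced) subgraph of g. *)
Definition is_subpath (T : finType) (g : rel T) (l : nat) (p : 'I_l -> T) :=
  injective p /\ {homo p : a b / path_graph a b >-> g a b}.

Section PathAligned.

(* The divisibility l | m is encoded by m = q * l, where q is the number of
   copies of g. Copy i consists of the vertices (i, x), and p i is the path
   P_l chosen in it. *)
Variables (T : finType) (g : rel T) (q l : nat) (p : 'I_q -> 'I_l -> T).

(* The k-th vertex of P_{q * l}, counting from 0, is identified with u. *)
Definition glued (k : 'I_(q * l)) (u : 'I_q * T) : bool :=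
  [exists a : 'I_l, (k == u.1 * l + a :> nat) && (u.2 == p u.1 a)].

(* Every vertex of P_{q * l} is glued to a vertex of a copy of g, so the
   vertices of the product are those of the copies. *)
Definition path_aligned : rel ('I_q * T) := fun u v =>
  (u.1 == v.1) && g u.2 v.2
  || [exists k, exists k', [&& path_graph k k', glued k u & glued k' v]].

Lemma path_aligned_sym : symmetric g -> symmetric path_aligned.
Proof.
move=> sg; have sub u v : path_aligned u v -> path_aligned v u.
  case/orP=> [/andP[/eqP e1 e2]|].
    by rewrite /path_aligned e1 eqxx sg e2.
  case/existsP=> k /existsP[k' /and3P[kk' ku k'v]].
  apply/orP; right; apply/existsP; exists k'; apply/existsP; exists k.
  by rewrite ku k'v /path_graph orbC -/(path_graph k k') kk'.
by move=> u v; apply/idP/idP; apply: sub.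
Qed.

Lemma path_aligned_irr :
  irreflexive g -> (forall i, is_subpath g (p i)) -> irreflexive path_aligned.
Proof.
move=> ig hp [i x]; rewrite /path_aligned /= ig andbF /=.
apply/existsP=> -[k /existsP[k' /and3P[kk' /existsP[a]]]].
case/andP=> /= /eqP ka /eqP xa /existsP[b /andP[/= /eqP kb /eqP xb]].
have ab : a = b by apply: (proj1 (hp i)); rewrite -xa -xb.
move: kk'; rewrite /path_graph ka kb ab => /orP[] /eqP /n_Sn //.
Qed.

End PathAligned.

(* Main.v *)
Require Import Defs.
From mathcomp Require Import all_boot.
From mathcomp Require Import zify.

(** The product is a chain of cycles.  In each cycle number the vertices
    0, ..., 4s+2 so that the glued path is 0, 1, 2; then vertex 2 of a cycle is
    joined to vertex 0 of the next one.

    Lower bound: on a cycle of length at least 7, a packing 3-colouring must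
    repeat with period 4.  Since 4(s+1) = (4s+3) + 1, two neighbours would get
    the same colour.

    Upper bound, five colours: colour every cycle by 2 1 e (1 2 1 3)^s, with e
    alternately 4 and 5 along the chain.  Upper bound, four colours and two
    cycles: use 2 1 (3 1 2 1)^s 4 followed by 1 2 (1 3 1 2)^s 4.  *)

Section Distances.
Variables (T : finType) (e : rel T).

Lemma dist_geP (x y : T) (d : nat) :
  reflect (forall n, walk e n x y -> d <= n) (dist_ge e x y d).
Proof.
rewrite /dist_ge /dist; case: {-}_ / boolP => [cxy|ncxy].
  case: ex_minnP => m wm minm; apply: (iffP idP) => [dm n /minm|->//].
  exact: leq_trans.
constructor=> n /existsP[q /andP[eq /eqP lq]]; case/negP: ncxy.
by apply/connectP; exists q.
Qed.

Lemma dist_ge_lipschitz (f : T -> nat) (x y : T) (d : nat) :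
  (forall u v, e u v -> f v <= (f u).+1) ->
  f x = 0 -> d <= f y -> dist_ge e x y d.
Proof.
move=> lip fx0 dfy; apply/dist_geP => n /existsP[q /andP[]].
suff main s : path e x s -> f (last x s) <= f x + size s.
  by move=> /main + /eqP ly; rewrite ly fx0 size_tuple; apply: leq_trans.
elim/last_ind: s => [|s z IHs]; first by rewrite addn0.
rewrite rcons_path last_rcons size_rcons addnS => /andP[/IHs le_s /lip].
by move/leq_trans; apply.
Qed.

Lemma walk_iter (h : nat -> T) (m d : nat) :
  (forall i, e (h i) (h i.+1)) -> walk e d (h m) (h (m + d)).
Proof.
move=> eh; have sz : size (map h (iota m.+1 d)) == d.
  by rewrite size_map size_iota.
apply/existsP; exists (Tuple sz) => /=.
elim: d m {sz} => [|d IHd] m /=; first by rewrite addn0 eqxx.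
by rewrite eh -addSnnS; apply: IHd.
Qed.

Lemma packing_chromatic_le (k : nat) :
  packing_colorable e k -> packing_chromatic e <= k.
Proof. by rewrite /packing_chromatic; case: ex_minnP => m _; apply. Qed.

End Distances.

Lemma ordS_val (n : nat) (x : 'I_n) :
  ordS x = (if x.+1 == n then 0 else x.+1) :> nat.
Proof.
rewrite /=; case: eqP => [->|/eqP ne]; first by rewrite modnn.
by rewrite modn_small // ltn_neqAle ne ltn_ord.
Qed.

(* Numbers the cycle so that the path p is 0, 1, 2, reversing the orientation
   when p runs against ordS. *)
Definition cycle_pos {n : nat} (p : 'I_3 -> 'I_n) (x : 'I_n) : nat :=
  let a : nat := p ord0 in
  if p (inord 1) == ordS (p ord0)
  then if a <= x then x - a else x + n - a
  else if x <= a then a - x else a + n - x.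

Definition cycle_adj (n x y : nat) : bool :=
  [|| y == x.+1, x == y.+1, (x == 0) && (y.+1 == n) | (y == 0) && (x.+1 == n)].

Lemma cycle_graphE (n : nat) (x y : 'I_n) : cycle_graph x y = cycle_adj n x y.
Proof.
rewrite /cycle_graph /cycle_adj -!(inj_eq val_inj).
rewrite [val (ordS x)]ordS_val [val (ordS y)]ordS_val /=.
by move: (ltn_ord x) (ltn_ord y); repeat case: ifP => ?; lia.
Qed.

Section CyclePos.
Variables (n : nat) (p : 'I_3 -> 'I_n).

Lemma cycle_pos_lt (x : 'I_n) : cycle_pos p x < n.
Proof.
rewrite /cycle_pos; have := ltn_ord x; have := ltn_ord (p ord0).
by repeat case: ifP => ?; lia.
Qed.

Lemma cycle_pos_inj : injective (cycle_pos p).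
Proof.
move=> x y; rewrite /cycle_pos => exy; apply/val_inj => /=; move: exy.
have := ltn_ord x; have := ltn_ord y; have := ltn_ord (p ord0).
by repeat case: ifP => ?; lia.
Qed.

Lemma cycle_pos_adj (x y : 'I_n) :
  cycle_graph x y -> cycle_adj n (cycle_pos p x) (cycle_pos p y).
Proof.
rewrite cycle_graphE /cycle_adj /cycle_pos; case: (_ == ordS _).
all: move: (ltn_ord x) (ltn_ord y) (ltn_ord (p ord0)).
all: by repeat case: ifP => ?; lia.
Qed.

Lemma cycle_pos_path (a : 'I_3) :
  is_subpath (@cycle_graph n) p -> cycle_pos p (p a) = a.
Proof.
case=> injp homp; have ltp b := ltn_ord (p b).
have e01 : cycle_graph (p ord0) (p (inord 1)).
  by apply: homp; rewrite /path_graph inordK.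
have e12 : cycle_graph (p (inord 1)) (p (inord 2)).
  by apply: homp; rewrite /path_graph !inordK.
have n02 : p ord0 != p (inord 2) :> nat.
  apply/eqP => /val_inj/injp/(congr1 val); by rewrite /= inordK.
have [->|->|->] : [\/ a = ord0, a = inord 1 | a = inord 2].
- have := ltn_ord a; case: (posnP a) => [a0 _|a0 a3].
    by constructor 1; apply: val_inj.
  have [a1|a1] := eqVneq (val a) 1.
    by constructor 2; apply: val_inj; rewrite /= inordK.
  constructor 3; apply: val_inj; rewrite /= inordK //; move: a1 => /=; lia.
- by rewrite /cycle_pos leqnn subnn; case: ifP.
all: move: e01 e12 n02 (ltp ord0) (ltp (inord 1)) (ltp (inord 2)).
all: rewrite !cycle_graphE /cycle_adj /cycle_pos -(inj_eq val_inj).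
all: rewrite [val (ordS _)]ordS_val inordK //=.
all: case: (eqVneq (p ord0).+1 n) => ?; by repeat case: ifP => ?; lia.
Qed.

End CyclePos.

Definition cycle_dist (n x y : nat) : nat :=
  minn ((x - y) + (y - x)) (n - ((x - y) + (y - x))).

Lemma cycle_distC (n x y : nat) : cycle_dist n x y = cycle_dist n y x.
Proof. by rewrite /cycle_dist (addnC (x - y)). Qed.

(* Each cycle strictly between two others costs 2 to cross and 1 to leave. *)
Definition chain_dist (n i x j y : nat) : nat :=
  if i == j then cycle_dist n x y
  else if i < j then cycle_dist n x 2 + 1 + 3 * (j - i.+1) + cycle_dist n 0 y
  else cycle_dist n x 0 + 1 + 3 * (i - j.+1) + cycle_dist n 2 y.

Section Chain.
Variables (n t : nat) (p : 'I_t -> 'I_3 -> 'I_n).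
Hypothesis n_gt3 : 3 < n.
Hypothesis hp : forall i, is_subpath (@cycle_graph n) (p i).

Let pos (u : 'I_t * 'I_n) : nat := cycle_pos (p u.1) u.2.
Let G : rel ('I_t * 'I_n) := path_aligned (@cycle_graph n) p.

Lemma path_aligned_adj (u v : 'I_t * 'I_n) : G u v ->
  [\/ u.1 = v.1 :> nat /\ cycle_adj n (pos u) (pos v),
      [/\ v.1 = u.1.+1 :> nat, pos u = 2 & pos v = 0]
    | [/\ u.1 = v.1.+1 :> nat, pos u = 0 & pos v = 2]].
Proof.
case: u v => [i x] [j y]; rewrite /G /path_aligned /pos /=.
case/orP => [/andP[/eqP -> /cycle_pos_adj adj]|]; first by constructor 1.
case/existsP=> k /existsP[k' /and3P[kk']].
case/existsP=> a /andP[/= /eqP ka /eqP ->].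
case/existsP=> b /andP[/= /eqP kb /eqP ->].
rewrite !cycle_pos_path //; move: kk'; rewrite /path_graph ka kb.
have := ltn_ord a; have := ltn_ord b => lb la /orP[] /eqP E.
- have [ij|ij] : i = j :> nat \/ j = i.+1 :> nat by lia.
    by constructor 1; split => //; rewrite /cycle_adj; lia.
  by constructor 2; split; lia.
- have [ij|ij] : i = j :> nat \/ i = j.+1 :> nat by lia.
    by constructor 1; split => //; rewrite /cycle_adj; lia.
  by constructor 3; split; lia.
Qed.

Lemma chain_dist_lipschitz (i x : nat) (u v : 'I_t * 'I_n) :
  x < n -> G u v ->
  chain_dist n i x v.1 (pos v) <= (chain_dist n i x u.1 (pos u)).+1.
Proof.
move=> xn /path_aligned_adj.
have := cycle_pos_lt _ (p u.1) u.2; have := cycle_pos_lt _ (p v.1) v.2.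
rewrite -/(pos u) -/(pos v) /chain_dist /cycle_dist /cycle_adj.
move: (nat_of_ord u.1) (nat_of_ord v.1) (pos u) (pos v) => j k y z zn yn.
case=> [[-> adj]|[-> -> ->]|[-> -> ->]].
- by case: ifP => _; [|case: ifP => _]; lia.
- by repeat case: ifP => ?; lia.
- by repeat case: ifP => ?; lia.
Qed.

Lemma chain_colorable (k : nat) (col : nat -> nat -> nat) :
  (forall i x, i < t -> x < n -> col i x < k) ->
  (forall i x y, i < t -> x < y -> y < n -> col i x = col i y ->
     (col i x).+1 < cycle_dist n x y) ->
  (forall i j x y, i < j -> j < t -> x < n -> y < n -> col i x = col j y ->
     (col i x).+1 < cycle_dist n x 2 + 1 + 3 * (j - i.+1) + cycle_dist n 0 y) ->
  packing_colorable G k.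
Proof.
move=> colk same diff.
have ltk (u : 'I_t * 'I_n) : col u.1 (pos u) < k.
  by apply: colk; rewrite ?cycle_pos_lt.
apply/existsP; exists [ffun u => Ordinal (ltk u)].
apply/forallP=> u; apply/forallP=> v; apply/implyP=> /andP[nuv].
rewrite !ffunE -(inj_eq val_inj) /= => /eqP ecol.
pose f (w : 'I_t * 'I_n) := chain_dist n u.1 (pos u) w.1 (pos w).
apply: (dist_ge_lipschitz _ _ f).
- by move=> w w'; apply: chain_dist_lipschitz; apply: cycle_pos_lt.
- by rewrite /f /chain_dist /cycle_dist eqxx !subnn min0n.
have up : pos u < n by apply: cycle_pos_lt.
have vp : pos v < n by apply: cycle_pos_lt.
rewrite addn1 /f /chain_dist; case: (ltngtP (u.1 : nat) v.1) => [uv|vu|uv].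
- exact: diff.
- rewrite ecol; apply: leq_trans (diff _ _ _ _ vu _ vp up (esym ecol)) _ => //.
  rewrite (cycle_distC n (pos u)) (cycle_distC n 2).
  have swap a b c : a + 1 + b + c <= c + 1 + b + a by lia.
  exact: swap.
have uv1 : u.1 = v.1 by apply: val_inj.
case: (ltngtP (pos u) (pos v)) => [lt|lt|E].
- by rewrite uv1 in ecol *; apply: same.
- rewrite ecol; apply: leq_trans (same v.1 _ _ _ lt up _) _ => //.
    by rewrite -ecol uv1.
  by rewrite cycle_distC.
move: E; rewrite /pos uv1 => /cycle_pos_inj uv2.
by case/eqP: nuv; rewrite [u]surjective_pairing uv1 uv2 -surjective_pairing.
Qed.

End Chain.

(* Colours are numbered from 0, one less than in the words of the header. *)
Definition alternating_coloring (i x : nat) : nat :=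
  if odd x then 0 else if 4 %| x then 1 else
  if x == 2 then (if odd i then 4 else 3) else 2.

Definition two_cycle_coloring (n i x : nat) : nat :=
  if x.+1 == n then 3 else
  if i == 0 then (if odd x then 0 else if 4 %| x then 1 else 2)
  else (if odd x then (if 4 %| x.+1 then 2 else 1) else 0).

Section UpperBounds.
Variables (s t : nat) (p : 'I_t -> 'I_3 -> 'I_(4 * s + 3)).
Hypothesis s_gt0 : 0 < s.
Hypothesis hp : forall i, is_subpath (@cycle_graph (4 * s + 3)) (p i).

Lemma colorable5 :
  packing_colorable (path_aligned (@cycle_graph (4 * s + 3)) p) 5.
Proof.
apply: (@chain_colorable _ _ _ _ hp _ alternating_coloring); first by lia.
- by move=> i x _ _; rewrite /alternating_coloring; repeat case: ifP => _.
- move=> i x y _ xy yn; rewrite /alternating_coloring /cycle_dist.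
  by repeat case: ifP => ? //; lia.
- move=> i j x y ij _ xn yn; rewrite /alternating_coloring /cycle_dist.
  by repeat case: ifP => ? //; lia.
Qed.

Lemma colorable4 : t <= 2 ->
  packing_colorable (path_aligned (@cycle_graph (4 * s + 3)) p) 4.
Proof.
move=> t2.
apply: (@chain_colorable _ _ _ _ hp _ (two_cycle_coloring (4 * s + 3))).
- by lia.
- by move=> i x _ _; rewrite /two_cycle_coloring; repeat case: ifP => _.
- move=> i x y _ xy yn; rewrite /two_cycle_coloring /cycle_dist.
  by repeat case: ifP => ? //; lia.
- move=> i j x y ij jt xn yn; rewrite /two_cycle_coloring /cycle_dist.
  by repeat case: ifP => ? //; lia.
Qed.

End UpperBounds.

(* Some packing words 1 2 3 1 2 cannot be extended, so the period only appears
   in the middle of a window: all words of length 9 are enumerated. *)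
Lemma packing3_period4 (w : nat -> nat) :
  (forall m, w m < 3) ->
  (forall m d, 0 < d < 4 -> w m = w (m + d) -> w m + 2 <= d) ->
  forall m, w (m + 2) = w (m + 6).
Proof.
move=> w3 far.
have f1 m : w m != w (m + 1) by apply/eqP => /(far m 1 isT); lia.
have f2 m : (w m == w (m + 2)) ==> (w m == 0).
  by apply/implyP => /eqP/(far m 2 isT); lia.
have f3 m : (w m == w (m + 3)) ==> (w m <= 1).
  by apply/implyP => /eqP/(far m 3 isT); lia.
move=> m.
move: (w3 m) (f1 m) (f2 m) (f3 m).
move: (w3 (m + 1)) (f1 (m + 1)) (f2 (m + 1)) (f3 (m + 1)).
move: (w3 (m + 2)) (f1 (m + 2)) (f2 (m + 2)) (f3 (m + 2)).
move: (w3 (m + 3)) (f1 (m + 3)) (f2 (m + 3)) (f3 (m + 3)).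
move: (w3 (m + 4)) (f1 (m + 4)) (f2 (m + 4)) (f3 (m + 4)).
move: (w3 (m + 5)) (f1 (m + 5)) (f2 (m + 5)) (f3 (m + 5)).
move: (w3 (m + 6)) (f1 (m + 6)) (f2 (m + 6)).
move: (w3 (m + 7)) (f1 (m + 7)) (w3 (m + 8)).
rewrite -!addnA !addnE /=.
move: (w m) (w (m + 1)) (w (m + 2)) (w (m + 3)) => a0 a1 a2 a3.
move: (w (m + 4)) (w (m + 5)) (w (m + 6)) (w (m + 7)) (w (m + 8)).
move=> a4 a5 a6 a7 a8 {w w3 far f1 f2 f3}.
case: a2 => [|[|[|a2]]] //; case: a3 => [|[|[|a3]]] //.
all: case: a4 => [|[|[|a4]]] //; case: a5 => [|[|[|a5]]] //.
all: case: a6 => [|[|[|a6]]] //; case: a1 => [|[|[|a1]]] //.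
all: case: a7 => [|[|[|a7]]] //; case: a0 => [|[|[|a0]]] //.
all: by case: a8 => [|[|[|a8]]].
Qed.

Section LowerBound.
Variables (s t : nat) (p : 'I_t -> 'I_3 -> 'I_(4 * s + 3)).
Hypotheses (s_gt0 : 0 < s) (t_gt0 : 0 < t).

Let n_gt0 : 0 < 4 * s + 3. Proof. by lia. Qed.

Lemma colorable_ge4 (k : nat) :
  packing_colorable (path_aligned (@cycle_graph (4 * s + 3)) p) k -> 4 <= k.
Proof.
case/existsP=> c /forallP hc; rewrite leqNgt; apply/negP => k4.
pose h m : 'I_t * 'I_(4 * s + 3) :=
  (Ordinal t_gt0, Ordinal (ltn_pmod m n_gt0)).
have eh m : path_aligned (@cycle_graph (4 * s + 3)) p (h m) (h m.+1).
  rewrite /path_aligned eqxx /= /cycle_graph -(inj_eq val_inj) /=.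
  by rewrite -addn1 -[in X in _ == X]addn1 modnDml eqxx.
pose w m : nat := c (h m).
have w3 m : w m < 3 by rewrite /w; have := ltn_ord (c (h m)); lia.
have far m d : 0 < d < 4 -> w m = w (m + d) -> w m + 2 <= d.
  move=> /andP[d0 d4] ew; have /forallP/(_ (h (m + d)))/implyP := hc (h m).
  have -> : h m != h (m + d).
    rewrite xpair_eqE -!(inj_eq val_inj) /= -{1}(addn0 m) eqn_modDl.
    by rewrite mod0n modn_small; lia.
  rewrite -(inj_eq val_inj) /= -/(w m) -/(w (m + d)) ew eqxx => /(_ isT).
  move/dist_geP/(_ d); rewrite walk_iter // => /(_ isT); lia.
have per q : w (2 + 4 * q) = w 2.
  elim: q => [|q <-]; first by rewrite muln0.
  rewrite (_ : 2 + 4 * q.+1 = 4 * q + 6); last by lia.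
  by rewrite -(packing3_period4 w w3 far) addnC.
have w23 : w 2 = w (2 + 1).
  rewrite -(per s.+1) /w; congr (c (_, _) : nat); apply: val_inj => /=.
  by rewrite (_ : 2 + 4 * s.+1 = 3 + (4 * s + 3)) ?modnDr //; lia.
by have := far 2 1 isT w23; lia.
Qed.

End LowerBound.

Theorem theorem13 (s t : nat) (hs : 1 <= s) (ht : 1 <= t)
  (p : 'I_t -> 'I_3 -> 'I_(4 * s + 3))
  (hp : forall i : 'I_t, is_subpath (@cycle_graph (4 * s + 3)) (p i)) :
  [/\ 1 <= t <= 2 ->
        packing_chromatic (path_aligned (@cycle_graph (4 * s + 3)) p) <= 4,
      3 <= t ->
        packing_chromatic (path_aligned (@cycle_graph (4 * s + 3)) p) <= 5
    & t = 1 \/ t = 2 ->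
        packing_chromatic (path_aligned (@cycle_graph (4 * s + 3)) p) = 4].
Proof.
have le4 : t <= 2 ->
    packing_chromatic (path_aligned (@cycle_graph (4 * s + 3)) p) <= 4.
  by move=> t2; apply/packing_chromatic_le/colorable4.
split=> [/andP[_ /le4]//|_|t12]; first exact/packing_chromatic_le/colorable5.
apply/eqP; rewrite eqn_leq le4 ?andTb; last by case: t12 => ->.
rewrite /packing_chromatic; case: ex_minnP => k ck _.
exact: colorable_ge4 ck.
Qed.
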